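(* For any finite functional signature $\Sigma$ which contains at least one constant symbol, and which contains at least one binary function symbol or at least two unary function symbols, there exists a non-initial algebra $\mathcal{A}$ over $\Sigma$, generated by the constants of $\Sigma$, with a polynomial time word problem.
   Context: An algebra over $\Sigma$ is a $\Sigma$-structure with all operations total. $\mathcal{F}$ denotes the algebra of all ground terms (terms without variables) over $\Sigma$. An equation is an expression $p=q$ with $p,q$ terms over $\Sigma$, possibly containing variables (understood as universally quantified). For a set $\Gamma$ of equations, $\sim_\Gamma$ is the congruence on $\mathcal{F}$ given by $p\sim_\Gamma q$ iff $\Gamma\vdash p=q$ (equivalently, the smallest congruence on $\mathcal{F}$ containing all ground instances of equations in $\Gamma$), and $\mathcal{F}_\Gamma=\mathcal{F}/{\sim_\Gamma}$. An algebra is initial if it is isomorphic to $\mathcal{F}_\Gamma$ for some finite set $\Gamma$ of equations (not necessarily between ground terms); otherwise it is non-initial. The word problem of an algebra $\mathcal{A}$ generated by its constants is: given ground terms $u,t$, decide whether $\mathcal{A}\models u=t$. It is polynomial time if it is decidable in time polynomial in $|u|+|t|$, where the size $|t|$ of a ground term is the number of nodes of its syntax tree. *)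

(* Defs.v *)
From mathcomp Require Import all_boot all_order all_algebra.
From mathcomp Require Import boolp classical_sets functions cardinality.

Set Implicit Arguments.
Unset Strict Implicit.
Unset Printing Implicit Defensive.

(* ** Signatures, terms, algebras *)

(* Constants are the symbols of arity 0. *)
Record signature := Signature {
  symb :> finType;
  arity : symb -> nat
}.

Inductive term (S : signature) (V : Type) : Type :=
| Var of V
| App (f : S) of 'I_(arity f) -> term S V.

Arguments Var {S V} _.
Arguments App {S V} f _.

Definition gterm (S : signature) := term S void.

Fixpoint subst S V W (s : V -> term S W) (t : term S V) : term S W :=
  match t with
  | Var x => s x
  | App f a => App f (fun i => subst s (a i))
  end.

Definition of_gterm S (t : gterm S) : term S nat :=
  subst (of_void (term S nat)) t.

Fixpoint term_size S (t : gterm S) : nat :=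
  match t with
  | Var x => of_void nat x
  | App f a => (\sum_(i < arity f) term_size (a i)).+1
  end.

Record algebra (S : signature) := Algebra {
  carrier :> Type;
  op : forall f : S, ('I_(arity f) -> carrier) -> carrier
}.

Arguments op {S} _ _ _.

Fixpoint geval S (A : algebra S) (t : gterm S) : A :=
  match t with
  | Var x => of_void A x
  | App f a => op A f (fun i => geval A (a i))
  end.

Definition generated_by_constants S (A : algebra S) : Prop :=
  forall x : A, exists t : gterm S, geval A t = x.

Definition isomorphic S (A B : algebra S) : Prop :=
  exists h : A -> B, bijective h /\
    forall (f : S) (a : 'I_(arity f) -> A), h (op A f a) = op B f (h \o a).

(* ** Equational logic and the algebras F_Gamma *)

Definition equation (S : signature) := (term S nat * term S nat)%type.

Inductive derivable S (Gamma : set (equation S)) :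
  term S nat -> term S nat -> Prop :=
| derivable_inst l r s :
    Gamma (l, r) -> derivable Gamma (subst s l) (subst s r)
| derivable_refl p : derivable Gamma p p
| derivable_sym p q : derivable Gamma p q -> derivable Gamma q p
| derivable_trans p q r :
    derivable Gamma p q -> derivable Gamma q r -> derivable Gamma p r
| derivable_congr (f : S) (a b : 'I_(arity f) -> term S nat) :
    (forall i, derivable Gamma (a i) (b i)) ->
    derivable Gamma (App f a) (App f b).

Section FreeAlgebra.
Variables (S : signature) (Gamma : set (equation S)).

Definition gcong : rel {classic gterm S} :=
  fun p q => `[< derivable Gamma (of_gterm p) (of_gterm q) >].

Lemma gcong_refl : reflexive gcong.
Proof. by move=> p; apply/asboolP; apply: derivable_refl. Qed.

Lemma gcong_sym : symmetric gcong.
Proof.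
by move=> p q; apply/asboolP/asboolP => h; apply: derivable_sym.
Qed.

Lemma gcong_trans : transitive gcong.
Proof.
move=> q p r /asboolP pq /asboolP qr; apply/asboolP.
exact: derivable_trans pq qr.
Qed.

Definition gcong_equiv := EquivRel gcong gcong_refl gcong_sym gcong_trans.

Definition free_carrier := {eq_quot gcong_equiv}%qT.

Definition free_op (f : S) (a : 'I_(arity f) -> free_carrier) : free_carrier :=
  (\pi_free_carrier (App f (fun i => repr (a i)) : {classic gterm S}))%qT.

Definition free_algebra : algebra S := Algebra free_op.

(* The operations do not depend on the representatives picked by [repr]. *)
Lemma free_opE (f : S) (a : 'I_(arity f) -> gterm S) :
  op free_algebra f (fun i => \pi_free_carrier (a i : {classic gterm S}))%qT
  = (\pi_free_carrier (App f a : {classic gterm S}))%qT.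
Proof.
apply/eqmodP/asboolP; apply: derivable_congr => i; apply/asboolP.
suff : (repr (\pi_free_carrier (a i : {classic gterm S}))
        = a i %[mod free_carrier])%qT by move/eqmodP.
exact: reprK.
Qed.

End FreeAlgebra.

Definition initial_algebra S (A : algebra S) : Prop :=
  exists Gamma : set (equation S),
    finite_set Gamma /\ isomorphic A (free_algebra Gamma).

(* ** Deterministic multitape Turing machines *)

Inductive move := Left | Stay | Right.

(* [(l, r)] is the two-way infinite tape whose contents read from left to
   right are [rev l ++ r], blank elsewhere, with the head on the first cell
   of [r] (a blank cell if [r] is empty). *)
Definition tape (C : Type) := (seq (option C) * seq (option C))%type.

Definition tape_read C (t : tape C) : option C := head None t.2.

Definition tape_write C (c : option C) (t : tape C) : tape C :=
  (t.1, c :: behead t.2).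

Definition tape_move C (m : move) (t : tape C) : tape C :=
  match m with
  | Left => (behead t.1, head None t.1 :: t.2)
  | Stay => t
  | Right => (tape_read t :: t.1, behead t.2)
  end.

(* The tape alphabet is the input alphabet [I] plus auxiliary symbols, plus
   the blank [None]. A state [q] with [tm_output q = Some b] is halting, with
   answer [b]. *)
Record turing_machine (I : finType) := TuringMachine {
  tm_tapes : nat;
  tm_state : finType;
  tm_aux : finType;
  tm_start : tm_state;
  tm_output : tm_state -> option bool;
  tm_delta : tm_state -> {ffun 'I_tm_tapes.+1 -> option (I + tm_aux)} ->
    tm_state * ('I_tm_tapes.+1 -> option (I + tm_aux) * move)
}.

Definition tm_config I (M : turing_machine I) :=
  (tm_state M * ('I_(tm_tapes M).+1 -> tape (I + tm_aux M)))%type.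

Definition tm_init I (M : turing_machine I) (w : seq I) : tm_config M :=
  (tm_start M, fun k => ([::], if k == ord0 then map (Some \o inl) w else [::])).

Definition tm_step I (M : turing_machine I) (c : tm_config M) : tm_config M :=
  if tm_output c.1 is Some _ then c else
  let: (q, act) := tm_delta c.1 [ffun k => tape_read (c.2 k)] in
  (q, fun k => tape_move (act k).2 (tape_write (act k).1 (c.2 k))).

Definition tm_answers I (M : turing_machine I) (w : seq I) (n : nat)
    (b : bool) : Prop :=
  tm_output (iter n (@tm_step I M) (tm_init M w)).1 = Some b.

(* ** Word problems *)

(* Prefix (Polish) notation: uniquely readable, as the arities are fixed. *)
Fixpoint prefix_word S (t : gterm S) : seq S :=
  match t with
  | Var x => of_void (seq S) x
  | App f a => f :: flatten [seq prefix_word (a i) | i <- enum 'I_(arity f)]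
  end.

Lemma size_prefix_word S (t : gterm S) : size (prefix_word t) = term_size t.
Proof.
elim: t => [[]|f a IH] /=; congr _.+1.
rewrite size_flatten /shape -map_comp sumnE big_map big_enum /=.
exact: eq_bigr.
Qed.

(* The letter [None] of the input alphabet separates the two terms. *)
Definition word_problem_input S (u t : gterm S) : seq (option S) :=
  map Some (prefix_word u) ++ None :: map Some (prefix_word t).

Definition poly_time_word_problem S (A : algebra S) : Prop :=
  exists (M : turing_machine (option (symb S))) (p : {poly nat}),
    forall u t : gterm S, exists2 n : nat,
      n <= p.[(term_size u + term_size t)%N]%R &
      tm_answers M (word_problem_input u t) n `[< geval A u = geval A t >].

(* Main.v *)
Require Import Defs.
From mathcomp Require Import all_boot.
From mathcomp Require Import all_algebra.
From mathcomp Require Import zify.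
From Stdlib Require List Eqdep_dec.
From mathcomp Require Import boolp classical_sets cardinality.

(** In the algebra of ground terms that are good, all bad terms being collapsed
to a sink, equality of values is identity of terms up to the regular set of good
prefix words, which a Turing machine decides by copying one word and comparing.
A term is good if its prefix word has at most one pair of adjacent letters of a
certain kind: a letter [f] (unary case), or two letters [f] (binary case). The
terms [s_n = F (G^n (F c))], where [G x] and [F x] are [g x] and [f x] in the
unary case, [f (c, x)] and [f (f (c, c), x)] in the binary case, are bad while all
their proper subterms are good. Replacing a subterm of [s_n] containing [F c] by [c] or
[G c] makes it good, so that a valid equation small compared with [n] cannot have [s_n] as an
instance of one side only. Hence declaring [s_n] good too gives a model of any
given finite set of valid equations, in which [s_n] and [s_(n+1)] differ. *)

Set Implicit Arguments.
Unset Strict Implicit.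
Unset Printing Implicit Defensive.

(** The value of [side] at [hole] is a default that [plug] overwrites; a total function avoids a
    dependent type on the other argument places. *)
Record frame (S : signature) := Frame {
  head_symb : S;
  hole : 'I_(arity head_symb);
  side : 'I_(arity head_symb) -> gterm S
}.

Arguments Frame {S head_symb} hole side.
Arguments side {S} f i : rename.

(** * Ground terms and unique readability of prefix words *)

Section Terms.
Variable S : signature.
Implicit Types (t u v w : gterm S) (f g : S).

Lemma App_inj V f (a b : 'I_(arity f) -> term S V) : App f a = App f b -> a = b.
Proof.
case=> ab; apply: Eqdep_dec.inj_pair2_eq_dec ab.
exact: (@eq_comparable (symb S)).
Qed.

Lemma subst_subst U V W (r : V -> term S W) (s : U -> term S V) (p : term S U) :
  subst r (subst s p) = subst (fun x => subst r (s x)) p.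
Proof. by elim: p => //= f a IH; congr App; apply: funext. Qed.

Lemma subst_gterm (s : void -> gterm S) t : subst s t = t.
Proof. by elim: t => [[]|f a IH] /=; congr App; apply: funext. Qed.

Lemma of_gterm_subst (s : nat -> gterm S) p :
  of_gterm (subst s p) = subst (fun x => of_gterm (s x)) p.
Proof. exact: subst_subst. Qed.

Lemma subst_of_gterm (s : nat -> gterm S) t : subst s (of_gterm t) = t.
Proof. by rewrite /of_gterm subst_subst subst_gterm. Qed.

Lemma term_size_arg f (a : 'I_(arity f) -> gterm S) i :
  term_size (a i) < term_size (App f a).
Proof. by rewrite /= ltnS (bigD1 i) //= leq_addr. Qed.

(** The remainders [x] and [y] let the induction peel off the arguments one at a time. *)
Lemma cat_prefix_word_inj u v (x y : seq S) :
  prefix_word u ++ x = prefix_word v ++ y -> u = v /\ x = y.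
Proof.
elim: u v x y => [[]|f a IH] [[]|g b] x y //= [fg]; case: g / fg b => b.
have : forall s, flatten [seq prefix_word (a i) | i <- s] ++ x =
    flatten [seq prefix_word (b i) | i <- s] ++ y ->
    (forall i, i \in s -> a i = b i) /\ x = y.
  elim=> //= i s IHs; rewrite -!catA => /IH[abi /IHs[ab xy]].
  by split=> // j; rewrite inE => /orP[/eqP->|/ab].
move=> /(_ (enum 'I_(arity f))) H /H[ab ->]; split=> //.
by congr App; apply: funext => i; apply: ab; rewrite mem_enum.
Qed.

Lemma prefix_word_inj : injective (@prefix_word S).
Proof.
move=> u v uv; have [|//] := @cat_prefix_word_inj u v [::] [::].
by rewrite uv.
Qed.

Lemma prefix_word_arg f (a : 'I_(arity f) -> gterm S) i :
  exists x y, prefix_word (App f a) = x ++ prefix_word (a i) ++ y.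
Proof.
have /path.splitPr : i \in enum 'I_(arity f) by rewrite mem_enum.
rewrite /=; case=> s1 s2; rewrite map_cat flatten_cat /= -cat_cons.
by eexists; eexists.
Qed.

Lemma exists_constant_term c :
  arity c = 0 -> exists t, prefix_word t = [:: c].
Proof.
move=> c0.
have no : 'I_(arity c) -> False by case=> i; rewrite c0.
exists (App c (fun i => False_rect _ (no i))) => /=.
suff -> : enum 'I_(arity c) = [::] by [].
by case: (enum _) => // i; case: (no i).
Qed.

(** * The algebra of good terms with a sink *)

Section Sink.
Variable P : gterm S -> Prop.
Hypothesis P_arg : forall f (a : 'I_(arity f) -> gterm S) i, P (App f a) -> P (a i).

Definition sink_eq u v := u = v \/ ~ P u /\ ~ P v.

Lemma sink_eq_sym u v : sink_eq u v -> sink_eq v u.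
Proof. by case=> [->|[]]; [left|right]. Qed.

Lemma sink_eq_trans u v w : sink_eq u v -> sink_eq v w -> sink_eq u w.
Proof. by case=> [->//|[Pu Pv]] [<-|[_ Pw]]; right. Qed.

(** Where [a] and [b] differ, both arguments are bad, and badness passes up to the whole terms by
    [P_arg]. *)
Lemma sink_eq_congr f (a b : 'I_(arity f) -> gterm S) :
  (forall i, sink_eq (a i) (b i)) -> sink_eq (App f a) (App f b).
Proof.
move=> ab; have [->|nab] := pselect (a = b); first by left.
have /existsNP[i abi] : ~ forall i, a i = b i by move/funext.
by right; case: (ab i) => // -[Pa Pb]; split=> /P_arg.
Qed.

(** Soundness of equational logic, stated for ground instances since derivations may pass through
    terms with variables. *)
Lemma derivable_sink_eq (Gamma : set (equation S)) p q (s : nat -> gterm S) :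
  (forall l r s, Gamma (l, r) -> sink_eq (subst s l) (subst s r)) ->
  derivable Gamma p q -> sink_eq (subst s p) (subst s q).
Proof.
move=> GP; elim=> {p q}.
- by move=> l r s0 /GP; rewrite !subst_subst; apply.
- by left.
- by move=> p q _ /sink_eq_sym.
- by move=> p q r _ pq _; apply: sink_eq_trans.
- by move=> f a b _ IH; apply: sink_eq_congr.
Qed.

(** [None] is the sink. The tuple [b] is determined by [a], so that the choice made by [cid] is
    harmless. *)
Definition sink_op f (a : 'I_(arity f) -> option {t | P t}) : option {t | P t} :=
  match pselect (exists b : 'I_(arity f) -> gterm S,
      (forall i, omap sval (a i) = Some (b i)) /\ P (App f b)) with
  | left h => Some (exist _ (App f (sval (cid h))) (proj2 (svalP (cid h))))
  | right _ => None
  end.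

Definition sink_algebra : algebra S := Algebra sink_op.

Lemma geval_sink t :
  omap sval (geval sink_algebra t) = if `[< P t >] then Some t else None.
Proof.
elim: t => [[]|f a IH] /=; rewrite /sink_op; case: pselect => h /=.
  case: (cid h) => b [ab Pb] /=.
  suff -> : a = b by rewrite asboolT.
  by apply: funext => i; have := ab i; rewrite IH; case: asboolP => // _ [].
case: asboolP => // Pa; case: h; exists a; split=> // i.
by rewrite IH asboolT //; apply: P_arg Pa.
Qed.

Lemma geval_sink_eq u v :
  geval sink_algebra u = geval sink_algebra v <-> sink_eq u v.
Proof.
have inj : injective (omap sval : option {t | P t} -> option (gterm S)).
  by move=> [[x px]|] [[y py]|] //= [xy]; congr Some; apply: eq_exist.
have -> : (geval sink_algebra u = geval sink_algebra v) <->
    omap sval (geval sink_algebra u) = omap sval (geval sink_algebra v).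
  by split=> [->//|/inj].
rewrite !geval_sink /sink_eq; do 2![case: asboolP]; intuition congruence.
Qed.

Lemma sink_generated : (exists t, ~ P t) -> generated_by_constants sink_algebra.
Proof.
move=> [t0 Pt0] x; case: x => [[t Pt]|].
  exists t; have := geval_sink t; rewrite asboolT //.
  by case: (geval _ _) => //= -[t' Pt'] [tt']; congr Some; apply: eq_exist.
by exists t0; have := geval_sink t0; rewrite asboolF //; case: (geval _ _).
Qed.

End Sink.

(** * Ground equalities in initial algebras *)

Lemma geval_free (Gamma : set (equation S)) t :
  geval (free_algebra Gamma) t
  = (\pi_(free_carrier Gamma) (t : {classic gterm S}))%qT.
Proof.
elim: t => [[]|f a IH]; rewrite -free_opE /=.
by congr free_op; apply: funext.
Qed.

Lemma geval_isomorphic (A B : algebra S) u v : isomorphic A B ->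
  geval A u = geval A v <-> geval B u = geval B v.
Proof.
case=> h [/bij_inj hI hop].
have hE t : h (geval A t) = geval B t.
  elim: t => [[]|f a IH] /=; rewrite hop.
  by congr op; apply: funext.
by rewrite -!hE; split=> [->//|/hI].
Qed.

Lemma initial_derivable (Gamma : set (equation S)) (A : algebra S) u v :
  isomorphic A (free_algebra Gamma) ->
  geval A u = geval A v <-> derivable Gamma (of_gterm u) (of_gterm v).
Proof.
move=> /geval_isomorphic ->; rewrite !geval_free.
by split=> [/eqmodP/asboolP|d]; last exact/eqmodP/asboolP.
Qed.

(** * Instances of small terms *)

(** The cases are whether the variable of [q] occurs; if so, [t] is a subterm of the instance,
    proper unless [q] is the variable itself. *)
Lemma subst_const_or_inj (q : term S unit) :
  (forall t u, subst (fun=> t) q = subst (fun=> u) q) \/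
  (forall t u, subst (fun=> t) q = subst (fun=> u) q -> t = u) /\
  (forall f b t, q = App f b -> term_size t < term_size (subst (fun=> t) q)).
Proof.
elim: q => [x|f a IH]; first by right.
have [aC|/existsNP[i aiC]] := pselect (forall i t u,
    subst (fun=> t) (a i) = subst (fun=> u) (a i)).
  by left=> t u /=; congr App; apply: funext.
right; have [//|[inj szi]] := IH i; split=> [t u /= /App_inj/(congr1 (@^~ i))/inj //|].
move=> g b t _; apply: leq_ltn_trans (term_size_arg (fun j => subst _ (a j)) i).
by case: (a i) szi => [//|g' b'] /(_ _ _ t erefl)/ltnW.
Qed.

Lemma subst_fixed_unique f a t1 t2 : let q : term S unit := App f a in
  subst (fun=> t1) q = t1 -> subst (fun=> t2) q = t2 -> t1 = t2.
Proof.
move=> q q1 q2; have [qC|[_ sz]] := subst_const_or_inj q.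
  by rewrite -q1 -q2.
by have := sz _ _ t1 erefl; rewrite q1 ltnn.
Qed.

(** The terms are compared symbol by symbol. A variable facing an application [q] would make [t1]
    and [t2] two solutions of [q(t) = t], which has at most one. *)
Lemma eq_subst_unit (p q : term S unit) t1 t2 : t1 <> t2 ->
  subst (fun=> t1) p = subst (fun=> t1) q ->
  subst (fun=> t2) p = subst (fun=> t2) q -> p = q.
Proof.
move=> t12; elim: p q => [[]|f a IH] [[]|g b] //.
- by move=> /esym q1 /esym q2; case: t12; apply: subst_fixed_unique q1 q2.
- by move=> q1 q2; case: t12; apply: subst_fixed_unique q1 q2.
move=> /= E1; have [fg _] := E1; case: g / fg b E1 => b /App_inj E1 /App_inj E2.
by congr App; apply: funext => i; apply: IH;
  [apply: (congr1 (@^~ i) E1) | apply: (congr1 (@^~ i) E2)].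
Qed.

Definition upd (s : nat -> gterm S) y t : nat -> gterm S :=
  fun x => if x == y then t else s x.

Lemma eq_subst_upd s y t1 t2 t (p q : term S nat) : t1 <> t2 ->
  subst (upd s y t1) p = subst (upd s y t1) q ->
  subst (upd s y t2) p = subst (upd s y t2) q ->
  subst (upd s y t) p = subst (upd s y t) q.
Proof.
(* Every variable but [y] is frozen at its ground value, leaving a term in one variable. *)
pose r x : term S unit :=
  if x == y then Var tt else subst (of_void (term S unit)) (s x).
have rE u l : subst (upd s y u) l = subst (fun=> u) (subst r l).
  rewrite subst_subst; congr subst; apply: funext => x.
  by rewrite /upd /r; case: eqP; rewrite //= subst_subst subst_gterm.
by rewrite !rE => t12 e1 e2; rewrite (eq_subst_unit t12 e1 e2).
Qed.

Lemma subst_upd_id s y (p : term S nat) : subst (upd s y (s y)) p = subst s p.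
Proof. by congr subst; apply: funext => x; rewrite /upd; case: eqP => // ->. Qed.

Lemma subst_upd_small s y t (p : term S nat) :
  term_size (subst s p) < term_size (s y) -> subst (upd s y t) p = subst s p.
Proof.
elim: p => [x|f a IH] /=; first by rewrite /upd; case: eqP => // ->; rewrite ltnn.
move=> H; congr App; apply: funext => i; apply: IH; apply: ltn_trans H.
exact: (term_size_arg (fun i => subst s (a i))).
Qed.

Definition plug (F : frame S) t : gterm S :=
  App (head_symb F) (fun i => if i == hole F then t else side F i).

Definition plugs (Fs : seq (frame S)) t := foldr plug t Fs.

Lemma term_size_plug F t : term_size t < term_size (plug F t).
Proof.
apply: leq_trans (term_size_arg (fun i => if i == hole F then t else side F i) (hole F)).
by rewrite eqxx.
Qed.

Lemma term_size_plugs Fs t : size Fs + term_size t <= term_size (plugs Fs t).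
Proof.
elim: Fs => //= F Fs IH; apply: leq_trans (term_size_plug F _).
by rewrite addSn ltnS.
Qed.

(** Variables count for nothing: this bounds how deep [p] can follow a chain before a variable is
    met. *)
Fixpoint open_size (p : term S nat) : nat :=
  match p with
  | Var x => 0
  | App f a => (\sum_(i < arity f) open_size (a i)).+1
  end.

(* The variable [y] of [p] inside the chain has a value larger than the sides,
hence does not occur in the arguments matching them. *)
Lemma subst_plugs_small Fs w s (p : term S nat) :
  List.Forall (fun F => forall i, term_size (side F i) < term_size w) Fs ->
  subst s p = plugs Fs w -> open_size p <= size Fs ->
  exists y k, term_size w <= term_size (s y) /\
    forall t, subst (upd s y t) p = plugs (take k Fs) t.
Proof.
move=> sideFs; elim: sideFs p => {Fs} [|F Fs sideF _ IH] [x|f a] //= spE szp.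
- by exists x, 0; split=> [|t]; rewrite ?spE // /upd eqxx.
- exists x, 0; split=> [|t]; last by rewrite /upd eqxx.
  rewrite spE; apply: leq_trans (ltnW (term_size_plug _ _)).
  exact: leq_trans (leq_addl _ _) (term_size_plugs _ _).
have [fF _] := spE; case: F sideF spE fF => g h e /= sideF spE fF.
case: g / fF h e sideF spE => h e sideF /App_inj spE.
have spEi i := congr1 (@^~ i) spE.
have [||y [k [szy ypE]]] := IH (a h).
- by have /= := spEi h; rewrite eqxx.
- by apply: leq_trans (_ : _ <= \sum_i open_size (a i)) szp; rewrite (bigD1 h) //= leq_addr.
exists y, k.+1; split=> // t /=; congr App; apply: funext => i /=.
case: eqP (spEi i) => [-> _|_ /= spi]; first exact: ypE.
by rewrite subst_upd_small spi // (leq_trans (sideF i)).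
Qed.

(** * Non-initiality *)

Section Counting.
(** The size conditions make [plug F c], the core of the seed, larger than all sides along the
    chain. *)
Variables (mu : gterm S -> nat) (F G : frame S) (c : gterm S).
Hypotheses (mu_arg : forall f (a : 'I_(arity f) -> gterm S) i,
              mu (a i) <= mu (App f a))
  (muF : forall t, mu (plug F t) = (mu t).+1)
  (muG : forall t, mu (plug G t) = mu t)
  (muc : mu c = 0)
  (sizec : forall i, term_size (side F i) < term_size (plug F c))
  (sizeG : forall i, term_size (side G i) < term_size (plug F c))
  (muF_side : forall i, mu (side F i) <= 1).

Definition good t := mu t <= 1.

Lemma good_arg f (a : 'I_(arity f) -> gterm S) i : good (App f a) -> good (a i).
Proof. exact: leq_trans. Qed.

Lemma mu_plugsG n t : mu (plugs (nseq n G) t) = mu t.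
Proof. by elim: n => //= n IH; rewrite muG. Qed.

Definition seed n := plugs (F :: nseq n G) (plug F c).

Lemma mu_seed n : mu (seed n) = 2.
Proof. by rewrite /= muF mu_plugsG muF muc. Qed.

Lemma seed_inj : injective seed.
Proof.
pose D n := term_size (plugs (nseq n G) (plug F c)).
have D_lt m n : m < n -> D m < D n.
  elim: n => // n IH; rewrite ltnS leq_eqVlt => /orP[/eqP->|/IH mn].
    exact: term_size_plug.
  exact: ltn_trans mn (term_size_plug _ _).
move=> m n /App_inj/(congr1 (@^~ (hole F))); rewrite eqxx => E.
have {E} : D m = D n by congr term_size.
by case: (ltngtP m n) => // /D_lt + E; rewrite E ltnn.
Qed.

(** The goodness predicate of the competing model of [Gamma], in which [seed n] is kept out of the
    sink. *)
Definition good_or_seed n t := good t \/ t = seed n.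

Lemma good_or_seed_arg n f (a : 'I_(arity f) -> gterm S) i :
  good_or_seed n (App f a) -> good_or_seed n (a i).
Proof.
case=> [ga|]; first by left; apply: good_arg ga.
rewrite /seed /=; set u := plugs _ _; rewrite /plug.
have mu_u : mu u = 1 by rewrite mu_plugsG muF muc.
case: (F) muF_side => g h e /= muE E; left.
have [fg _] := E; case: g / fg h e muE E => h e muE /App_inj -> /=.
by case: eqP => _; [rewrite /good mu_u | apply: muE].
Qed.

(* Instances of small valid equations cannot move the seed: the equation would
   stay valid after replacing a large subterm of the seed by [c] and [G c],
   where its left side is good, so that its two sides coincide. *)
Lemma valid_instance_seed n (l r : term S nat) (s : nat -> gterm S) :
  (forall s, sink_eq good (subst s l) (subst s r)) -> open_size l <= n.+1 ->
  subst s l = seed n -> subst s r = seed n.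
Proof.
move=> valid szl slE.
(* The chain above [plug F c] has [n.+1] frames, which is the bound on [open_size l]. *)
have [| |y [k [_ lE]]] := @subst_plugs_small (F :: nseq n G) _ _ _ _ slE.
- by constructor=> //; elim: n {szl slE} => [|n IH]; constructor.
- by rewrite /= size_nseq.
(* The new value replaces a subterm containing the inner [F], so that at most the outer one remains,
   and none if [k = 0]. *)
have goodE t : mu t = 0 -> good (subst (upd s y t) l).
  move=> mut; rewrite lE /good; case: k {lE} => [|k] /=; first by rewrite mut.
  rewrite muF ltnS; suff -> : take k (nseq n G) = nseq (minn k n) G.
    by rewrite mu_plugsG mut.
  by elim: k n {szl slE} => [|k IH] [|n] //=; rewrite IH minnSS.
have validE t : mu t = 0 -> subst (upd s y t) l = subst (upd s y t) r.
  by move=> /goodE gl; case: (valid (upd s y t)) => // -[].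
rewrite -slE -(subst_upd_id s y l) -(subst_upd_id s y r); apply/esym.
(* Agreement of both sides at the distinct values [c] and [plug G c] gives agreement at the original
   value [s y]. *)
apply: (@eq_subst_upd _ _ c (plug G c)); rewrite ?validE ?muG //.
by move=> cE; have := term_size_plug G c; rewrite -cE ltnn.
Qed.

Lemma sink_noninitial : ~ initial_algebra (sink_algebra good).
Proof.
case=> Gamma [finG iso].
have [n szn] : exists n, forall l r, Gamma (l, r) ->
    open_size l <= n /\ open_size r <= n.
  pose sz (e : equation S) := open_size e.1 + open_size e.2.
  have /finite_seqP[ns nsE] := finite_image sz finG.
  exists (\max_(m <- ns) m) => l r lr.
  have : (sz @` Gamma)%classic (sz (l, r)) by exists (l, r).
  rewrite nsE /= => lr_ns; have /= le_sz := @leq_bigmax_seq _ ns xpredT id _ lr_ns isT.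
  by split; apply: leq_trans le_sz; rewrite ?leq_addr ?leq_addl.
have valid l r (s : nat -> gterm S) : Gamma (l, r) ->
    sink_eq good (subst s l) (subst s r).
  move=> lr; apply/(geval_sink_eq good_arg)/(initial_derivable _ _ iso).
  by rewrite !of_gterm_subst; apply: derivable_inst.
(* Both seeds are bad, so the sink algebra identifies them and [Gamma] would derive their
   equality. *)
have : sink_eq good (seed n) (seed n.+1).
  by right; rewrite /good !mu_seed.
move=> /(geval_sink_eq good_arg)/(initial_derivable _ _ iso).
move=> /(derivable_sink_eq (@good_or_seed_arg n) (fun=> c)).
rewrite !subst_of_gterm; case.
(* Two bad sides could be separated only if exactly one were [seed n], which [valid_instance_seed]
   excludes in both directions. *)
- move=> l r s lr; have [szl szr] := szn _ _ lr.
  have [|[bl br]] := valid _ _ s lr; first by left.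
  have [sl|sl] := pselect (subst s l = seed n).
    by left; rewrite sl (valid_instance_seed _ _ sl) // ?leqW // => s'; apply: valid.
  have [sr|sr] := pselect (subst s r = seed n); last by right; split=> -[].
  left; rewrite sr (valid_instance_seed _ _ sr) // ?leqW // => s'.
  exact/sink_eq_sym/valid.
- by move/seed_inj/n_Sn.
- by case=> + _; case; right.
Qed.

End Counting.

End Terms.
(** * Deciding equality up to a regular set *)

Section Machine.
Variables (T Q : finType) (q0 : Q) (d : Q -> T -> Q) (acc : pred Q).

Local Notation cell := (option (option T + void)).
Local Notation letter x := (Some (inl (Some x)) : cell).

(* Copying the first word to the second tape, rewinding the second tape,
   comparing, halting. The automaton [d] runs while a word is read. *)
Definition eq_state := (Q + bool + bool * Q * bool + bool)%type.

Definition copying q : eq_state := inl (inl (inl q)).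
Definition rewinding b : eq_state := inl (inl (inr b)).
Definition comparing b q e : eq_state := inl (inr (b, q, e)).
Definition halted b : eq_state := inr b.

Definition eq_output (s : eq_state) := if s is inr b then Some b else None.

Definition two_tapes X (x y : X) (k : 'I_2) : X := if k == ord0 then x else y.

(** In [comparing b q e], [b] is the verdict on the first word, [q] the run on the second, [e] the
    agreement so far. The test [y == None] detects a longer first word. *)
Definition eq_delta (s : eq_state) (rd : {ffun 'I_2 -> cell}) :
    eq_state * ('I_2 -> cell * move) :=
  let x := rd ord0 in let y := rd ord_max in
  match s with
  | inl (inl (inl q)) =>
      if x is Some (inl (Some a))
      then (copying (d q a), two_tapes (x, Right) (x, Right))
      else (rewinding (acc q), two_tapes (x, Right) (y, Left))
  | inl (inl (inr b)) =>
      if y is Some _ then (s, two_tapes (x, Stay) (y, Left))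
      else (comparing b q0 true, two_tapes (x, Stay) (y, Right))
  | inl (inr (b, q, e)) =>
      if x is Some (inl (Some a))
      then (comparing b (d q a) (e && (y == x)), two_tapes (x, Right) (y, Right))
      else (halted (e && (y == None) || ~~ b && ~~ acc q),
            two_tapes (x, Stay) (y, Stay))
  | inr _ => (s, two_tapes (x, Stay) (y, Stay))
  end.

Definition eq_machine : turing_machine (option T) :=
  @TuringMachine (option T) 1 eq_state void (copying q0) eq_output eq_delta.

Definition config s t0 t1 : tm_config eq_machine := (s, two_tapes t0 t1).

Local Notation step := (@tm_step _ eq_machine).

Lemma step_config s t0 t1 : eq_output s = None ->
  step (config s t0 t1) =
  let: (s', act) :=
    eq_delta s (finfun (two_tapes (tape_read t0) (tape_read t1))) in
  config s' (tape_move (act ord0).2 (tape_write (act ord0).1 t0))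
            (tape_move (act ord_max).2 (tape_write (act ord_max).1 t1)).
Proof.
rewrite /tm_step /= => ->.
have -> : [ffun k => tape_read (two_tapes t0 t1 k)] =
    finfun (two_tapes (tape_read t0) (tape_read t1)).
  by apply/ffunP => k; rewrite !ffunE /two_tapes; case: ifP.
case: eq_delta => s' act; congr pair; apply: funext => k.
rewrite /two_tapes; case: eqP => [->//|k0].
by have -> : k = ord_max by apply/val_inj; case: k k0 => [[|[]]] // ? [];
  apply/val_inj.
Qed.

Lemma copy_letter q a L0 r0 t1 :
  step (config (copying q) (L0, letter a :: r0) t1) =
  config (copying (d q a)) (letter a :: L0, r0) (letter a :: t1.1, behead t1.2).
Proof. by rewrite step_config //= !ffunE. Qed.

Lemma iter_copy w q L0 r0 L1 :
  iter (size w)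
    step (config (copying q) (L0, [seq letter a | a <- w] ++ r0) (L1, [::])) =
  config (copying (foldl d q w)) ([seq letter a | a <- rev w] ++ L0, r0)
    ([seq letter a | a <- rev w] ++ L1, [::]).
Proof.
elim: w q L0 L1 => [|a w IH] q L0 L1 //.
by rewrite iterSr [_ ++ _]/= copy_letter IH rev_cons map_rcons !cat_rcons.
Qed.

(** The blank written on leaving the copy stays as its explicit end mark, the [[:: None]] of
    [agreeE]. *)
Lemma copy_end q L0 r0 L1 :
  step (config (copying q) (L0, Some (inl None) :: r0) (L1, [::])) =
  config (rewinding (acc q)) (Some (inl None) :: L0, r0)
    (behead L1, [:: head None L1; None]).
Proof. by rewrite step_config //= !ffunE. Qed.

(** Writing back the cell that was read turns an empty right half into an explicit blank, with the
    same tape contents. *)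
Definition unread (r : seq cell) := head None r :: behead r.

(** The first tape stands still but is rewritten at each step, hence known only up to [unread]. *)
Lemma iter_rewind w b L0 r0 r1 : exists r0',
  [/\ head None r0' = head None r0, behead r0' = behead r0 &
  iter (size w) step
    (config (rewinding b) (L0, r0)
      (behead [seq letter a | a <- w], head None [seq letter a | a <- w] :: r1)) =
  config (rewinding b) (L0, r0')
    ([::], None :: catrev [seq letter a | a <- w] r1)].
Proof.
elim: w r0 r1 => [|a w IH] r0 r1; first by exists r0.
have [r0' [h0 b0 E]] := IH (unread r0) (letter a :: r1).
exists r0'; split=> //; rewrite iterSr step_config //= !ffunE /=.
exact: E.
Qed.

Lemma rewind_end b L0 r0 r1 :
  step (config (rewinding b) (L0, r0) ([::], None :: r1)) =
  config (comparing b q0 true) (L0, unread r0) ([:: None], r1).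
Proof. by rewrite step_config //= !ffunE. Qed.

Fixpoint agree (e : bool) (w : seq T) (r1 : seq cell) : bool :=
  if w is a :: w' then agree (e && (head None r1 == letter a)) w' (behead r1)
  else e && (head None r1 == None).

Lemma agree_false w r1 : agree false w r1 = false.
Proof. by elim: w r1 => /=. Qed.

Lemma agreeE w v : agree true w ([seq letter a | a <- v] ++ [:: None]) = (v == w).
Proof.
elim: w v => [|a w IH] [|b v] //=; first by rewrite agree_false.
rewrite eqseq_cons -[letter b == letter a]/(b == a).
by case: eqP => // _; rewrite agree_false.
Qed.

Lemma compare_letter b q e a L0 r0 L1 r1 :
  step (config (comparing b q e) (L0, letter a :: r0) (L1, r1)) =
  config (comparing b (d q a) (e && (head None r1 == letter a)))
    (letter a :: L0, r0) (head None r1 :: L1, behead r1).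
Proof. by rewrite step_config //= !ffunE. Qed.

Lemma iter_compare w b q e L0 r0 L1 r1 : head None r0 = None ->
  eq_output (iter (size w).+1 step
    (config (comparing b q e) (L0, [seq letter a | a <- w] ++ r0) (L1, r1))).1 =
  Some (agree e w r1 || ~~ b && ~~ acc (foldl d q w)).
Proof.
move=> r00; elim: w q e L0 L1 r1 => [|a w IH] q e L0 L1 r1.
  by rewrite /= step_config //= !ffunE /= /tape_read /= r00.
by rewrite iterSr [_ ++ _]/= compare_letter IH.
Qed.

Lemma eq_machine_answers (v w : seq T) :
  tm_answers eq_machine (map Some v ++ None :: map Some w)
    ((size v).*2 + size w + 3)
    ((v == w) || ~~ acc (foldl d q0 v) && ~~ acc (foldl d q0 w)).
Proof.
rewrite /tm_answers.
have -> : tm_init eq_machine (map Some v ++ None :: map Some w) =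
    config (copying q0) ([::], [seq letter a | a <- v] ++
      Some (inl None) :: [seq letter a | a <- w]) ([::], [::]).
  congr pair; apply: funext => k; rewrite /two_tapes.
  by case: ifP; rewrite // map_cat /= -!map_comp.
(* From right to left: copy, separator, rewind, turn, compare with a last step to halt. *)
have -> : (size v).*2 + size w + 3 = (size w).+1 + (1 + (size v + (1 + size v))).
  by rewrite -addnn; lia.
rewrite !iterD iter_copy /= copy_end.
rewrite !cats0 -(size_rev v); set r0 := [seq letter a | a <- w].
have [r0' [h0 b0 ->]] := iter_rewind (rev v) (acc (foldl d q0 v))
  (Some (inl None) :: [seq letter a | a <- rev v]) r0 [:: None].
rewrite rewind_end /unread h0 b0 map_rev catrevE revK -agreeE.
have [r1 [-> r10]] : exists r1, head None r0 :: behead r0 = r0 ++ r1 /\ head None r1 = None.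
  by rewrite /r0; case: (w) => [|a w']; [exists [:: None] | exists [::]; rewrite /= cats0].
rewrite -iterS; exact: iter_compare.
Qed.

End Machine.

Lemma poly_time_word_problem_regular (S : signature) (A : algebra S)
    (Q : finType) (q0 : Q) (d : Q -> S -> Q) (acc : pred Q) :
  (forall u t, geval A u = geval A t <->
    sink_eq (fun t => acc (foldl d q0 (prefix_word t))) u t) ->
  poly_time_word_problem A.
Proof.
(* The polynomial is [2X + 3], whose value is at least [2|u| + |t| + 3]. *)
move=> AE; exists (eq_machine q0 d acc), ('X * 2%:R%:P + 3%:R%:P)%R => u t.
exists ((size (prefix_word u)).*2 + size (prefix_word t) + 3).
  rewrite !size_prefix_word.
  have -> : ('X * 2%:R%:P + 3%:R%:P : {poly nat}).[(term_size u + term_size t)%N]%R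
    = (term_size u + term_size t) * 2 + 3.
    by rewrite hornerD hornerM hornerX !hornerC.
  lia.
have -> : `[< geval A u = geval A t >] =
    (prefix_word u == prefix_word t) ||
    ~~ acc (foldl d q0 (prefix_word u)) && ~~ acc (foldl d q0 (prefix_word t)).
  apply/asboolP/idP => [/AE[->|[/negP-> /negP->]]|]; rewrite ?eqxx ?orbT //.
  move=> /orP[/eqP/prefix_word_inj->//|/andP[/negP nu /negP nt]].
  by apply/AE; right.
exact: eq_machine_answers.
Qed.

(** * Counting pairs of adjacent letters *)

Section Adjacent.
Variables (T : Type) (e : rel T).

Fixpoint adjacent (w : seq T) : nat :=
  if w is x :: w' then (if w' is y :: _ then e x y else false) + adjacent w' else 0.

Lemma adjacent_suffix v w : adjacent w <= adjacent (v ++ w).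
Proof. by elim: v => //= x v IH; apply: leq_trans IH (leq_addl _ _). Qed.

Lemma adjacent_prefix v w : adjacent v <= adjacent (v ++ w).
Proof. by elim: v => [|x [|y v] IH] //=; rewrite leq_add2l. Qed.

(* The state is the previous letter, and whether one, resp. two, pairs were met. *)
Definition adjacent_step (q : option T * bool * bool) (y : T) :=
  let hit := if q.1.1 is Some x then e x y else false in
  (Some y, q.1.2 || hit, q.2 || q.1.2 && hit).

Lemma foldl_adjacent_step w x s b :
  (foldl adjacent_step (Some x, s, b) w).2 = b || (1 < s + adjacent (x :: w)).
Proof.
elim: w x s b => [|y w IH] x s b /=; first by case: s; rewrite orbF.
rewrite IH /=; case: b s (e x y) => [] [] [] //=.
Qed.

Lemma adjacent_step_correct w :
  ~~ (foldl adjacent_step (None, false, false) w).2 = (adjacent w <= 1).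
Proof. by case: w => //= x w; rewrite foldl_adjacent_step /= -leqNgt. Qed.

End Adjacent.

Section Frames.
Variables (S : signature) (e : rel S) (c : gterm S) (F G : frame S).
Let mu (t : gterm S) := adjacent e (prefix_word t).
Hypotheses (muF : forall t, mu (plug F t) = (mu t).+1)
  (muG : forall t, mu (plug G t) = mu t)
  (muc : mu c = 0)
  (sizeF : forall i, term_size (side F i) < term_size (plug F c))
  (sizeG : forall i, term_size (side G i) < term_size (plug F c))
  (muF_side : forall i, mu (side F i) <= 1).

Lemma adjacent_noninitial : exists A : algebra S,
  ~ initial_algebra A /\ generated_by_constants A /\ poly_time_word_problem A.
Proof.
have mu_arg f (a : 'I_(arity f) -> gterm S) i : mu (a i) <= mu (App f a).
  rewrite /mu; have [x [y ->]] := prefix_word_arg a i.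
  exact: leq_trans (adjacent_prefix _ _ _) (adjacent_suffix _ _ _).
exists (sink_algebra (good mu)); split; [|split].
- exact: (@sink_noninitial _ _ F G c).
- apply: sink_generated; first exact: good_arg.
  by exists (seed F G c 0); rewrite /good (mu_seed muF).
apply: (@poly_time_word_problem_regular _ _ _ (None, false, false)
  (adjacent_step e) (fun q => ~~ q.2)) => u t.
suff -> : (fun t : gterm S => is_true (~~ (foldl (adjacent_step e)
    (None, false, false) (prefix_word t)).2)) = good mu.
  exact/geval_sink_eq/good_arg.
by apply: funext => v; rewrite adjacent_step_correct.
Qed.

End Frames.

(** * The frames of the binary and unary cases *)

Lemma enum_ord1 n : n = 1 -> forall i : 'I_n, enum 'I_n = [:: i].
Proof. by move=> ->  i; apply: (inj_map val_inj); rewrite val_enum_ord /= [i]ord1. Qed.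

Lemma enum_ord2 n (i j : 'I_n) : n = 2 -> val i = 0 -> val j = 1 ->
  enum 'I_n = [:: i; j].
Proof.
by move=> n2 i0 j1; apply: (inj_map val_inj); rewrite val_enum_ord /= i0 j1 n2.
Qed.

Theorem theorem5p2 (S : signature)
    (hconst : exists c : S, arity c = 0)
    (hfun : (exists f : S, arity f = 2) \/
            (exists f g : S, f <> g /\ arity f = 1 /\ arity g = 1)) :
  exists A : algebra S,
    ~ initial_algebra A /\ generated_by_constants A /\
    poly_time_word_problem A.
Proof.
have [c /[dup] c0 /exists_constant_term[z zE]] := hconst.
case: hfun => [[f f2]|[f [g [fg [f1 g1]]]]].
- have i0p : 0 < arity f by rewrite f2.
  have i1p : 1 < arity f by rewrite f2.
  pose i0 := Ordinal i0p; pose i1 := Ordinal i1p.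
  have cf : (c == f) = false by apply/eqP => E; rewrite E f2 in c0.
  have wE s t : prefix_word (plug (Frame i1 (fun=> s)) t) =
      f :: prefix_word s ++ prefix_word t.
    by rewrite /= (enum_ord2 (i:=i0) (j:=i1) f2) //= cats0.
  (* [F x] is read as [f f c c] then [x], and [G x] as [f c] then [x]; the [c] before the hole
     prevents a pair across it. *)
  pose G := Frame i1 (fun=> z); pose F := Frame i1 (fun=> plug G z).
  pose e (x y : S) := (x == f) && (y == f).
  apply: (@adjacent_noninitial S e z F G) => [t|t||i|i|i].
  + rewrite !wE zE /= /e eqxx cf /=.
    by case: (prefix_word t) => //= *; rewrite cf !add0n.
  + rewrite !wE zE /= /e cf andbF /=.
    by case: (prefix_word t) => //= *; rewrite cf.
  + by rewrite zE /=.
  + by rewrite -!size_prefix_word !wE !zE.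
  + by rewrite -!size_prefix_word !wE !zE.
  + by rewrite [prefix_word _]wE zE /= /e cf andbF.
have f0p : 0 < arity f by rewrite f1.
have g0p : 0 < arity g by rewrite g1.
(* Each symbol has a single place, the hole, so that [z] is a mere default. *)
pose F := Frame (Ordinal f0p) (fun=> z); pose G := Frame (Ordinal g0p) (fun=> z).
have FE t : prefix_word (plug F t) = f :: prefix_word t.
  by rewrite /= (enum_ord1 f1 (hole F)) /= cats0.
have GE t : prefix_word (plug G t) = g :: prefix_word t.
  by rewrite /= (enum_ord1 g1 (hole G)) /= cats0.
(* The relation looks at the first letter only: every [f] is counted, since a symbol of arity one is
   never the last letter of a prefix word. *)
apply: (@adjacent_noninitial S (fun x _ => x == f) z F G) => [t|t||i|i|i].
- by rewrite FE /=; case: t => [[]|h a] /=; rewrite eqxx.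
- rewrite GE /=; have -> : (g == f) = false by apply/eqP => /esym.
  by case: (prefix_word t).
- by rewrite zE.
- by rewrite -!size_prefix_word FE.
- by rewrite -!size_prefix_word FE.
- by rewrite zE.
Qed.
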